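(* Let $G$ be a graph with $n$ nodes and $m$ edges, let $k\ge 1$ and let $b\ge 2$ be an integer. Online recursive $b$-section into $k$ blocks coupled with Fennel or LDG as the scoring rule has time complexity $O\big((m+nb)\log_b k\big)$.
   Context: One-pass streaming model: nodes of $G$ arrive one at a time together with their neighborhood $N(u)$ and must be permanently assigned to one of $k$ blocks on arrival. Multi-section tree for base $b$: the root covers the range of final blocks $\{1,\ldots,k\}$; a tree block covering a range $\{k_L,\ldots,k_R\}$ with $k_L<k_R$ has $\min\{b,k_R-k_L+1\}$ child sub-blocks whose ranges split $\{k_L,\ldots,k_R\}$ into roughly equal consecutive parts; a block with $k_L=k_R$ is a leaf and corresponds to a final block. Online recursive $b$-section: when node $u$ arrives, starting from the root it repeatedly chooses, among the children of the current tree block, the child maximizing a score, assigns $u$ to it and descends, until a leaf is reached; weights of all tree blocks are maintained. Scores for a candidate block $W$: Fennel uses $|W\cap N(u)|-\alpha\gamma|W|^{\gamma-1}$ (with a per-block constant $\alpha$ and constant $\gamma$); LDG uses $|W\cap N(u)|\,(1-|W|/L_W)$ with $L_W$ the capacity of $W$. Choosing among up to $b$ children costs $O(|N(u)|+b)$ time.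
   Formalization: The bound is proved with log_b k rounded up to an integer (number of levels) for all k ≥ 1, b ≥ 2, and with the real log_b k only if k = 1 or b ≤ k; for 1 < k < b the real-logarithm bound is false (e.g. complete graph, k = 2, b = √n). *)

(* Defs.v *)
From HB Require Import structures.
From mathcomp Require Import all_boot all_order all_algebra.
From mathcomp Require Import reals exp.

Set Implicit Arguments.
Unset Strict Implicit.
Unset Printing Implicit Defensive.

Import Order.TTheory GRing.Theory Num.Theory.

(* Cost model: unit-cost RAM over nat and the reals.  A value of [costed A] is a
   result together with the number of elementary operations (table reads and
   writes, arithmetic, comparisons) spent on it. *)
Definition costed (A : Type) : Type := (nat * A)%type.

Definition ops (A : Type) (c : nat) (a : A) : costed A := (c, a).
Definition ret (A : Type) (a : A) : costed A := ops 0 a.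
Definition bind (A B : Type) (x : costed A) (f : A -> costed B) : costed B :=
  (x.1 + (f x.2).1, (f x.2).2).

Notation "'let!' x := a 'in' p" := (bind a (fun x => p))
  (at level 200, x name, a at level 200, p at level 200).

Fixpoint foldC (A B : Type) (f : B -> A -> costed B) (z : B) (s : seq A) :
    costed B :=
  if s is x :: s' then let! y := f z x in foldC f y s' else ret z.

Definition write (A : eqType) (B : Type) (f : A -> B) (a : A) (y : B) : A -> B :=
  fun x => if x == a then y else f x.

(* A tree block is identified with its range [W.1 .. W.2] of final blocks; two
   different blocks of a multi-section tree have different ranges, because an
   inner block has at least two children. *)
Definition block : Type := (nat * nat)%type.

Definition width (W : block) : nat := W.2.+1 - W.1.
Definition brange (W : block) : seq nat := iota W.1 (width W).

Inductive tree_block (k : nat) (children : block -> seq block) : block -> Prop :=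
| TreeRoot : tree_block k children (1, k)
| TreeChild W X : tree_block k children W -> W.1 < W.2 ->
    X \in children W -> tree_block k children X.

(* "Roughly equal" parts: widths differing by at most one. *)
Definition multisection_tree (b k : nat) (children : block -> seq block) : Prop :=
  forall W, tree_block k children W -> W.1 < W.2 ->
    [/\ size (children W) = minn b (W.2 - W.1 + 1),
        flatten (map brange (children W)) = brange W
      & {in children W &, forall X Y, width X <= (width Y).+1}].

Definition num_edges (T : finType) (e : rel T) : nat :=
  #|[set [set p.1; p.2] | p : T * T & e p.1 p.2]|.

(* The stream presents every node once, in any order, together with its
   neighborhood listed in any order. *)
Definition node_stream (T : finType) (e : rel T) (s : seq (T * seq T)) : Prop :=
  perm_eq (map fst s) (enum T) /\
  {in s, forall p, perm_eq p.2 (enum (e p.1))}.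

Inductive scoring (R : realType) : Type :=
| Fennel (alpha : block -> R) (gamma : R)
| LDG (capacity : block -> R).

(* Score of a candidate [W] from x = |W :&: N(u)| and w = |W|; the charge is the
   number of arithmetic operations and parameter look-ups in the formula. *)
Definition score (R : realType) (rule : scoring R) (W : block) (x w : nat) :
    costed R :=
  match rule with
  | Fennel alpha gamma =>
      ops 6 (x%:R - alpha W * gamma * (w%:R `^ (gamma - 1)))%R
  | LDG capacity => ops 4 (x%:R * (1 - w%:R / capacity W))%R
  end.

(* [loc v l]: the tree block at depth [l] to which [v] has been assigned (the
   root, at depth 0, is left implicit); [weight W] = |W|; [counter]: scratch
   table used to accumulate |W :&: N(u)|. *)
Record state (T : Type) : Type := State {
  loc : T -> nat -> option block;
  weight : block -> nat;
  counter : block -> nat }.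

Definition init_state (T : Type) : state T :=
  State (fun _ _ => None) (fun _ => 0) (fun _ => 0).

(* After this, [c W] = |W :&: N(u)| for each of the children [W], [l] being their
   depth.  Neighbors lying in other blocks of depth [l] increment counters that
   are not read before being reset. *)
Definition count_in_blocks (T : eqType) (st : state T) (children : seq block)
    (l : nat) (N : seq T) : costed (block -> nat) :=
  let! c0 := foldC (fun c W => ops 1 (write c W 0)) (counter st) children in
  foldC (fun c v =>
      let! o := ops 1 (loc st v l) in
      if o is Some W then
        let! x := ops 1 (c W) in ops 1 (write c W x.+1)
      else ret c)
    c0 N.

(* Linear scan of the nonempty list [W :: Ws] for a child of maximal score.
   [tie X Y] decides whether [Y] replaces the incumbent [X] on equal scores. *)
Definition argmax (R : realType) (rule : scoring R) (tie : block -> block -> bool)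
    (c w : block -> nat) (W : block) (Ws : seq block) : costed block :=
  let eval X :=
    let! x := ops 1 (c X) in
    let! y := ops 1 (w X) in
    score rule X x y in
  let! s0 := eval W in
  let! best := foldC (fun best X =>
      let! s := eval X in
      let! better := ops 2 ((best.2 < s)%R || (s == best.2) && tie best.1 X) in
      ret (if better then (X, s) else best))
    (W, s0) Ws in
  ret best.1.

Definition assign (T : eqType) (st : state T) (c : block -> nat) (u : T)
    (l : nat) (W : block) : costed (state T) :=
  let! loc' := ops 1 (write (loc st) u (write (loc st u) l (Some W))) in
  let! w := ops 1 (weight st W) in
  let! weight' := ops 1 (write (weight st) W w.+1) in
  ret (State loc' weight' c).

(* Descent of [u] from [W], a block at depth [l], to a leaf, which is returned.
   The leaf test is charged to the iteration it opens.  Ranges shrink strictly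
   along a descent in a multi-section tree, so fuel [k] is never exhausted when
   starting from the root. *)
Fixpoint descend (R : realType) (T : eqType) (children : block -> seq block)
    (rule : scoring R) (tie : T -> block -> block -> bool) (fuel : nat)
    (st : state T) (u : T) (N : seq T) (l : nat) (W : block) :
    costed (state T * block) :=
  match fuel, children W with
  | fuel'.+1, X :: Xs =>
      if W.1 < W.2 then
        let! _ := ops 1 tt in
        let! c := count_in_blocks st (X :: Xs) l.+1 N in
        let! Y := argmax rule (tie u) c (weight st) X Xs in
        let! st' := assign st c u l.+1 Y in
        descend children rule tie fuel' st' u N l.+1 Y
      else ret (st, W)
  | _, _ => ret (st, W)
  end.

(* Processes the stream; the result lists the final block of every node.  The
   delivery of the stream and the emission of the result are not charged. *)
Definition online_multisection (R : realType) (T : eqType) (k : nat)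
    (children : block -> seq block) (rule : scoring R)
    (tie : T -> block -> block -> bool) (s : seq (T * seq T)) :
    costed (state T * seq (T * nat)) :=
  foldC (fun acc p =>
      let! r := descend children rule tie k acc.1 p.1 p.2 0 (1, k) in
      ret (r.1, rcons acc.2 (p.1, r.2.1)))
    (init_state T, [::]) s.

Definition running_time (R : realType) (T : eqType) (k : nat)
    (children : block -> seq block) (rule : scoring R)
    (tie : T -> block -> block -> bool) (s : seq (T * seq T)) : nat :=
  (online_multisection k children rule tie s).1.

(* Main.v *)
Require Import Defs.
From HB Require Import structures.
From mathcomp Require Import all_boot all_order all_algebra.
From mathcomp Require Import reals exp.
From mathcomp Require Import zify.
Import Order.TTheory GRing.Theory Num.Theory.

(** One level of the descent of a node [u] costs at most [13 b + 3 |N(u)|].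
    Since [d] siblings have widths differing by at most one and summing to the
    width [w] of their parent, a child of width [M] satisfies
    [d (M - 1) < w]; with [d = min b w] this shows that a parent of
    width at most [b ^ j.+1] only has children of width at most [b ^ j].  Hence
    a descent has at most [up_log b k] levels, and the handshake lemma sums the
    costs of all nodes. *)

Lemma bind_cost (A B : Type) (x : costed A) (f : A -> costed B) (p q : nat) :
  x.1 <= p -> (f x.2).1 <= q -> (bind x f).1 <= p + q.
Proof. exact: leq_add. Qed.

(** The bound depends on the entry but not on the accumulator, so no invariant on intermediate
    states has to be tracked. *)
Lemma foldC_cost (A : eqType) (B : Type) (f : B -> A -> costed B) (g : A -> nat)
    (s : seq A) (z : B) :
  (forall y x, x \in s -> (f y x).1 <= g x) ->
  (foldC f z s).1 <= \sum_(x <- s) g x.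
Proof.
elim: s z => [|x s IHs] z fg; first by rewrite big_nil.
rewrite big_cons /= leq_add ?fg ?mem_head // IHs // => y x' x's.
by rewrite fg // in_cons x's orbT.
Qed.

Lemma foldC_cost_const {A : eqType} {B : Type} {f : B -> A -> costed B}
    {g : nat} (s : seq A) (z : B) :
  (forall y x, (f y x).1 <= g) -> (foldC f z s).1 <= g * size s.
Proof.
move=> fg; have := @foldC_cost _ _ f (fun=> g) s z (fun y x _ => fg y x).
by rewrite big_const_seq count_predT iter_addn_0.
Qed.

Lemma foldC_ind (A : eqType) (B : Type) (P : B -> Prop) (f : B -> A -> costed B)
    (s : seq A) (z : B) :
  P z -> (forall y x, x \in s -> P y -> P (f y x).2) -> P (foldC f z s).2.
Proof.
elim: s z => [|x s IHs] z //= Pz fP; apply: IHs => [|y x' x's Py].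
  by apply: fP => //; rewrite mem_head.
by apply: fP => //; rewrite in_cons x's orbT.
Qed.

Lemma score_cost (R : realType) (rule : scoring R) W x w :
  (score rule W x w).1 <= 6.
Proof. by case: rule. Qed.

Lemma count_in_blocks_cost (T : eqType) (st : state T) Ws l (N : seq T) :
  (count_in_blocks st Ws l N).1 <= size Ws + 3 * size N.
Proof.
rewrite leq_add //=.
  by rewrite -[leqRHS]mul1n; apply: foldC_cost_const.
by apply: foldC_cost_const => c v /=; case: (loc st v l).
Qed.

(** An evaluation takes two table reads and a score of cost at most 6; each later candidate adds 2
    for the comparison. *)
Lemma argmax_cost (R : realType) (rule : scoring R) tie c w W Ws :
  (argmax rule tie c w W Ws).1 <= 8 + 10 * size Ws.
Proof.
rewrite /argmax /= addn0 leq_add //.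
  by have := score_cost R rule W (c W) (w W); lia.
apply: foldC_cost_const => y X /=.
by have := score_cost R rule X (c X) (w X); lia.
Qed.

(** Keeps the descent inside the tree, where the multi-section property is available. *)
Lemma argmax_mem (R : realType) (rule : scoring R) tie c w W Ws :
  (argmax rule tie c w W Ws).2 \in W :: Ws.
Proof.
rewrite /argmax /=.
apply: (@foldC_ind _ _ (fun y => y.1 \in W :: Ws)) => [|y X XWs yWs] /=.
  exact: mem_head.
by case: ifP => //= _; rewrite in_cons XWs orbT.
Qed.

(** Apart from one occurrence of [M], every entry is at least [M - 1], and that occurrence supplies
    the extra 1. The case [M = 0] is separate because [M.-1] truncates. *)
Lemma sum_nearly_equal (s : seq nat) (M : nat) :
  {in s &, forall x y, x <= y.+1} -> M \in s -> size s * M.-1 < sumn s \/ M = 0.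
Proof.
case: M => [|M] near Ms; [by right | left].
rewrite (perm_sumn (perm_to_rem Ms)) /= (perm_size (perm_to_rem Ms)) /= mulSn.
rewrite addSn ltnS leq_add2l.
have: all (leq M) (rem M.+1 s).
  by apply/allP => x /mem_rem xs; have := near _ _ Ms xs.
by elim: (rem M.+1 s) => //= x r IHr /andP[Mx /IHr]; rewrite mulSn; lia.
Qed.

Lemma child_width (b k j : nat) (children : block -> seq block) (W X : block) :
  0 < b -> multisection_tree b k children -> tree_block k children W ->
  W.1 < W.2 -> X \in children W -> width W <= b ^ j.+1 -> width X <= b ^ j.
Proof.
move=> b0 tree tW ltW XW wW; have [szW flatW near] := tree W tW ltW.
have sumW : sumn (map width (children W)) = width W.
  transitivity (size (brange W)); last by rewrite size_iota.
  rewrite -flatW size_flatten /shape -map_comp; congr sumn.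
  by apply: eq_map => Y /=; rewrite size_iota.
have nearw : {in map width (children W) &, forall x y, x <= y.+1}.
  by move=> _ _ /mapP[Y YW ->] /mapP[Z ZW ->]; apply: near.
have bj : 0 < b ^ j by rewrite expn_gt0 b0.
have [|->//] := sum_nearly_equal _ _ nearw (map_f width XW).
rewrite size_map szW sumW; have <- : width W = W.2 - W.1 + 1.
  by rewrite /width; lia.
(* With [b] children, cancel [b] from [b * (width X).-1 < b ^ j.+1]. Otherwise there are [width W]
   children, and cancelling [width W] leaves [width X <= 1]. *)
have [bw|wb] := leqP b (width W).
  move=> /leq_trans/(_ wW); rewrite expnS ltn_pmul2l //; lia.
rewrite -[X in _ < X]muln1 ltn_mul2l => /andP[_]; lia.
Qed.

(** Induction on the exponent [j] rather than on the fuel: at [j = 0] the width is at most 1, so the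
    descent stops whatever fuel remains. *)
Lemma descend_cost (R : realType) (T : eqType) (b k j fuel : nat)
    (children : block -> seq block) (rule : scoring R)
    (tie : T -> block -> block -> bool) st u N l W :
  0 < b -> multisection_tree b k children -> tree_block k children W ->
  width W <= b ^ j ->
  (descend children rule tie fuel st u N l W).1 <= (13 * b + 3 * size N) * j.
Proof.
move=> b0 tree; elim: j fuel st l W => [|j IHj] [|fuel] st l W tW wW //=.
  case: (children W) => // X Xs; case: ifP => // ltW.
  by move: wW; rewrite /width expn0; lia.
case defW: (children W) => [|X Xs] //; case: ifP => // ltW.
have [szW _ _] := tree W tW ltW.
have szb : (size Xs).+1 <= b.
  by rewrite -[_.+1]/(size (X :: Xs)) -defW szW geq_minl.
(* The summands are leaf test, counting, scan, assignment and the remaining levels. With [d]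
   children, [1 <= d <= b], one level costs at most [11 * d + 2 + 3 * size N], hence at most [q]. *)
set q := _ + _; apply: (@leq_trans
  (1 + (size (X :: Xs) + 3 * size N + (8 + 10 * size Xs + (3 + q * j))))).
  apply: bind_cost => //; apply: bind_cost; first exact: count_in_blocks_cost.
  set c := _.2; apply: bind_cost; first exact: argmax_cost.
  have YW : (argmax rule (tie u) c (weight st) X Xs).2 \in children W.
    by rewrite defW; apply: argmax_mem.
  apply: bind_cost => //; apply: IHj; first exact: TreeChild tW ltW YW.
  exact: child_width tW ltW YW wW.
rewrite mulnS -[size (X :: Xs)]/((size Xs).+1).
by move: (q * j) => z; rewrite /q; lia.
Qed.

(* Each edge, as an unordered pair, comes from at most two ordered pairs. *)
Lemma sum_degrees_le (T : finType) (e : rel T) :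
  \sum_(u : T) #|e u| <= 2 * num_edges e.
Proof.
pose D := [set p : T * T | e p.1 p.2]; pose f (p : T * T) := [set p.1; p.2].
have -> : \sum_(u : T) #|e u| = #|D|.
  rewrite -sum1_card (eq_bigl (fun p : T * T => e p.1 p.2)); last first.
    by move=> p; rewrite inE.
  rewrite -(pair_big_dep predT e (fun _ _ => 1)) /=.
  by apply: eq_bigr => u _; rewrite sum1_card.
have -> : num_edges e = #|f @: D|.
  by congr #|pred_of_set _|; apply: eq_imset_set.
(* Count [D] by the fibres of [f]: the one over the edge of [(x, y)] lies in
   [[set (x, y); (y, x)]]. *)
rewrite -sum1_card (partition_big_imset f) /= mulnC -sum_nat_const.
apply: leq_sum => _ /imsetP[[x y] _ ->].
rewrite sum1dep_card; apply: (@leq_trans #|[set (x, y); (y, x)]|); last first.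
  by rewrite cards2; case: eqP.
apply/subset_leq_card/subsetP => -[x' y'].
rewrite !inE /f /= => /andP[_ /eqP E].
have: x' \in [set x; y] by rewrite -E set21.
have: y' \in [set x; y] by rewrite -E set22.
have: x \in [set x'; y'] by rewrite E set21.
have: y \in [set x'; y'] by rewrite E set22.
rewrite {E} !inE !xpair_eqE.
rewrite (eq_sym y x') (eq_sym y y') (eq_sym x x') (eq_sym x y').
by case: (x' == x); case: (x' == y); case: (y' == x); case: (y' == y).
Qed.

Lemma running_time_le (R : realType) (T : finType) (e : rel T) (k b : nat)
    (children : block -> seq block) (rule : scoring R)
    (tie : T -> block -> block -> bool) (s : seq (T * seq T)) :
  1 < b -> multisection_tree b k children -> node_stream e s ->
  running_time k children rule tie s
    <= 13 * ((num_edges e + #|T| * b) * up_log b k).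
Proof.
move=> b1 tree [s_enum s_nbr].
pose g (p : T * seq T) := (13 * b + 3 * #|e p.1|) * up_log b k.
apply: (@leq_trans (\sum_(p <- s) g p)).
  apply: foldC_cost => -[st out] p ps /=; rewrite addn0 /g cardE.
  rewrite -(perm_size (s_nbr p ps)); apply: (descend_cost _ _ _ k) => //.
  - exact: ltnW.
  - exact: TreeRoot.
  (* The root has width [k], so [j = up_log b k] is admissible. *)
  by rewrite /width subn1; apply: up_logP.
rewrite -big_distrl /= mulnA leq_mul2r; apply/orP; right.
rewrite -(big_map fst predT (fun u => 13 * b + 3 * #|e u|)).
rewrite (perm_big _ s_enum) /= big_enum /= big_split /= sum_nat_const.
rewrite -big_distrr /= mulnDr mulnCA addnC leq_add //.
apply: leq_trans (_ : 3 * (2 * num_edges e) <= _); last by lia.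
by rewrite leq_mul2l sum_degrees_le.
Qed.

(** Writing the rounded-up logarithm as [u + 1], [b ^ u < k] bounds [u] by the ratio of logarithms,
    and [b <= k] bounds the remaining 1 by the same ratio. *)
Lemma up_log_le_ln (R : realType) (b k : nat) : 1 < b -> b <= k ->
  ((up_log b k)%:R <= 2 * (ln k%:R / ln b%:R) :> R)%R.
Proof.
move=> b1 bk; have lnb : (0 < ln b%:R :> R)%R by rewrite ln_gt0 ?ltr1n.
have b0 : (0 < b%:R :> R)%R by rewrite ltr0n ltnW.
have k0 : (0 < k%:R :> R)%R by rewrite ltr0n (leq_trans _ bk) // ltnW.
rewrite mulrA ler_pdivlMr //.
have lnbk : (ln b%:R <= ln k%:R :> R)%R by rewrite ler_ln ?posrE ?ler_nat.
have := up_log_gtn b1 (leq_trans b1 bk).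
have : 0 < up_log b k by rewrite up_log_gt0 b1 (leq_trans b1).
case: (up_log b k) => // u _ ltk.
have le1 : (u%:R * ln b%:R <= ln k%:R :> R)%R.
  rewrite mulr_natl -lnXn // ler_ln ?posrE ?exprn_gt0 //.
  by rewrite -natrX ler_nat ltnW.
by rewrite -natr1 mulrDl mul1r [leRHS]mulr_natl mulr2n lerD.
Qed.

Theorem theorem4 :
  exists C : nat,
  forall (R : realType) (T : finType) (e : rel T) (k b : nat)
    (children : block -> seq block) (rule : scoring R)
    (tie : T -> block -> block -> bool) (s : seq (T * seq T)),
  symmetric e -> irreflexive e ->
  1 <= k -> 2 <= b ->
  multisection_tree b k children ->
  node_stream e s ->
  let n := #|T| in
  let m := num_edges e in
  let t := running_time k children rule tie s in
  t <= C * ((m + n * b) * up_log b k) /\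
  (k = 1 \/ b <= k ->
   (t%:R <= C%:R * ((m + n * b)%:R * (ln k%:R / ln b%:R)) :> R)%R).
Proof.
(* [26 = 13 * 2], the factor 2 paying for the rounding in [up_log]. *)
exists 26 => R T e k b children rule tie s _ _ _ b1 tree stream n m t.
have t_le : t <= 13 * ((m + n * b) * up_log b k) by apply: running_time_le.
split=> [|[k1|bk]]; first by apply: leq_trans t_le _; rewrite leq_mul2r orbT.
  move: t_le; rewrite k1 up_log1 !muln0 leqn0 => /eqP ->.
  by rewrite ln1 mul0r !mulr0.
have : (t%:R <= (13 * ((m + n * b) * up_log b k))%:R :> R)%R by rewrite ler_nat.
move/le_trans; apply; rewrite [(26)%N](_ : _ = 13 * 2) // !natrM -mulrA.
by rewrite ler_wpM2l ?ler0n // mulrCA ler_wpM2l ?ler0n ?up_log_le_ln.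
Qed.
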